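(* Let $n\ge 2$, let $f:\mathbb{R}^n\to\mathbb{R}$, and let $(\boldsymbol{x}_k)_{k\ge 1}$ be an infinite sequence of iterates generated by the algorithm 2D-MoSub (described in the context) applied to $\min_{\boldsymbol{x}\in\mathbb{R}^n} f(\boldsymbol{x})$, with associated orthonormal pairs of directions $\boldsymbol{d}_1^{(k)},\boldsymbol{d}_2^{(k)}\in\mathbb{R}^n$. Let $V_k=\operatorname{span}\{\boldsymbol{d}_1^{(k)},\boldsymbol{d}_2^{(k)}\}$ and let $\boldsymbol{P}_k$ be the orthogonal projection from $\mathbb{R}^n$ onto $V_k$. Assume that $f$ is bounded from below, twice continuously differentiable, and that its second-order derivative is bounded, with $C$ an upper bound on $\|\nabla^2 f\|$. Assume further that there exists an infinite set $\mathcal{K}\subseteq\{1,2,3,\dots\}$ such that 1) there exists $\varepsilon_1>0$ such that $\|\boldsymbol{P}_k\nabla f(\boldsymbol{x}_k)\|_2\ge \varepsilon_1\|\nabla f(\boldsymbol{x}_k)\|_2$ for all $k\in\mathcal{K}$; 2) $f(\boldsymbol{x}_{k+1})-\inf_{\boldsymbol{d}\in V_k} f(\boldsymbol{x}_k+\boldsymbol{d})\to 0$ as $k\in\mathcal{K}$, $k\to\infty$. Then $$\liminf_{k\to\infty}\|\nabla f(\boldsymbol{x}_k)\|_2=0.$$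
   Context: Notation. For $\boldsymbol a,\boldsymbol b\in\mathbb{R}^n$, $\mathcal{T}^{(k)}_{\boldsymbol a,\boldsymbol b}$ maps $\boldsymbol y\in \boldsymbol x_k+\operatorname{span}\{\boldsymbol a,\boldsymbol b\}$ to $(\langle \boldsymbol y-\boldsymbol x_k,\boldsymbol a\rangle,\langle \boldsymbol y-\boldsymbol x_k,\boldsymbol b\rangle)^\top\in\mathbb{R}^2$, and $\hat{\mathcal T}^{(k)}_{\boldsymbol a}$ maps $\boldsymbol y\in\boldsymbol x_k+\operatorname{span}\{\boldsymbol a\}$ to $\langle \boldsymbol y-\boldsymbol x_k,\boldsymbol a\rangle\in\mathbb{R}$. Algorithm 2D-MoSub. Input: $\boldsymbol x_0\in\mathbb{R}^n$, a direction $\boldsymbol d^{(1)}\in\mathbb{R}^n$, initial trust-region radius $\Delta_1>0$, lower bound $\Delta_{\rm low}$, increase factor $\gamma_1$ and decrease factor $\gamma_2$ for the radius, positive thresholds $\eta,\eta_0$. Step 0 (initialization). Put $\boldsymbol y_a=\boldsymbol x_0$, $\boldsymbol y_b=\boldsymbol x_0+\Delta_1\boldsymbol d^{(1)}$, and $\boldsymbol y_c=\boldsymbol y_a+2\Delta_1\boldsymbol d^{(1)}$ if $f(\boldsymbol y_a)\le f(\boldsymbol y_b)$, $\boldsymbol y_c=\boldsymbol y_a-\Delta_1\boldsymbol d^{(1)}$ otherwise. Let $\boldsymbol x_1$ be a minimizer and $\boldsymbol y_{\max}\ne\boldsymbol x_1$ a maximizer of $f$ over $\{\boldsymbol y_a,\boldsymbol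 y_b,\boldsymbol y_c\}$, and $\boldsymbol d_1^{(1)}=(\boldsymbol x_1-\boldsymbol y_{\max})/\|\boldsymbol x_1-\boldsymbol y_{\max}\|_2$. Let $Q_1^{\rm sub}(\alpha)=f(\boldsymbol x_1)+a^{(1)}\alpha+b^{(1)}\alpha^2$ be determined by $Q_1^{\rm sub}(\hat{\mathcal T}^{(1)}_{\boldsymbol d_1^{(1)}}(\boldsymbol y))=f(\boldsymbol y)$ for $\boldsymbol y\in\{\boldsymbol y_a,\boldsymbol y_b,\boldsymbol y_c\}$. Set $k=1$. Step 1. Choose (arbitrarily, e.g. randomly) a unit vector $\boldsymbol d_2^{(k)}$ with $\langle\boldsymbol d_1^{(k)},\boldsymbol d_2^{(k)}\rangle=0$. Put $\boldsymbol y_1^{(k)}=\boldsymbol x_k+\Delta_k\boldsymbol d_2^{(k)}$; $\boldsymbol y_2^{(k)}=\boldsymbol x_k+2\Delta_k\boldsymbol d_2^{(k)}$ if $f(\boldsymbol y_1^{(k)})\le f(\boldsymbol x_k)$ and $\boldsymbol y_2^{(k)}=\boldsymbol x_k-\Delta_k\boldsymbol d_2^{(k)}$ otherwise; $\boldsymbol y_3^{(k)}=\boldsymbol y_{\min,2}^{(k)}+\Delta_k\boldsymbol d_1^{(k)}$, where $\boldsymbol y_{\min,2}^{(k)}$ minimizes $f$ over $\{\boldsymbol y_1^{(k)},\boldsymbol y_2^{(k)}\}$. Step 2. Let $Q_k(\alpha,\beta)=f(\boldsymbol x_k)+a^{(k)}\alpha+b^{(k)}\alpha^2+c^{(k)}\beta+d^{(k)}\beta^2+e^{(k)}\alpha\beta$,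 where $a^{(k)},b^{(k)}$ are the coefficients of $Q_k^{\rm sub}$ and $c^{(k)},d^{(k)},e^{(k)}$ are determined by $Q_k(\mathcal T^{(k)}_{\boldsymbol d_1^{(k)},\boldsymbol d_2^{(k)}}(\boldsymbol z))=f(\boldsymbol z)$ for $\boldsymbol z\in\{\boldsymbol y_1^{(k)},\boldsymbol y_2^{(k)},\boldsymbol y_3^{(k)}\}$. Step 3 (trial step). Let $(\alpha^{(k)},\beta^{(k)})$ solve $\min Q_k(\alpha,\beta)$ subject to $\alpha^2+\beta^2\le\Delta_k^2$; let $\boldsymbol x_k^{\rm pre}=\boldsymbol x_k+\alpha^{(k)}\boldsymbol d_1^{(k)}+\beta^{(k)}\boldsymbol d_2^{(k)}$ and let $\boldsymbol x_k^+$ be a minimizer of $f$ over $\{\boldsymbol x_k,\boldsymbol x_k^{\rm pre},\boldsymbol y_1^{(k)},\boldsymbol y_2^{(k)},\boldsymbol y_3^{(k)}\}$. (i) If $\boldsymbol x_k^+\in\{\boldsymbol x_k,\boldsymbol x_{k-1}\}$, set $\boldsymbol x_{k+1}=\boldsymbol x_k$, $\Delta_{k+1}=\Delta_k$, $\boldsymbol d_1^{(k+1)}=\boldsymbol d_1^{(k)}$ (overriding the updates of Step 4) and go to Step 4. (ii) Otherwise compute $\rho_k=\dfrac{f(\boldsymbol x_k^+)-f(\boldsymbol x_k)}{Q_k(\mathcal T^{(k)}_{\boldsymbol d_1^{(k)},\boldsymbol d_2^{(k)}}(\boldsymbol x_k^+))-Q_k(0,0)}$. If $\rho_k\ge\eta$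 or $\boldsymbol x_k^+\in\{\boldsymbol y_1^{(k)},\boldsymbol y_2^{(k)},\boldsymbol y_3^{(k)}\}$, set $\boldsymbol x_{k+1}=\boldsymbol x_k^+$ and go to Step 4. (iii) Otherwise let $Q_k^{\rm mod}$ be the bivariate quadratic polynomial interpolating $f$ (in the coordinates $\mathcal T^{(k)}_{\boldsymbol d_1^{(k)},\boldsymbol d_2^{(k)}}$) at the six points $\{\boldsymbol x_{k-1},\boldsymbol x_k,\boldsymbol x_k^+,\boldsymbol y_1^{(k)},\boldsymbol y_2^{(k)},\boldsymbol y_3^{(k)}\}$ if $\boldsymbol x_k\neq\boldsymbol x_{k-1}$, $\{\boldsymbol x_k,\boldsymbol x_k^+,\boldsymbol y_1^{(k)},\boldsymbol y_2^{(k)},\boldsymbol y_3^{(k)},\boldsymbol y_4^{(k)}\}$ if $\boldsymbol x_k=\boldsymbol x_{k-1}$ and $\boldsymbol x_k^+\ne\boldsymbol y_4^{(k)}$, and $\{\boldsymbol x_k,\boldsymbol x_k^+,\boldsymbol y_1^{(k)},\boldsymbol y_2^{(k)},\boldsymbol y_3^{(k)},\boldsymbol y_5^{(k)}\}$ otherwise, where $\boldsymbol y_4^{(k)}=\boldsymbol x_k+\frac{\sqrt2}{2}\Delta_k\boldsymbol d_1^{(k)}+\frac{\sqrt2}{2}\Delta_k\boldsymbol d_2^{(k)}$ and $\boldsymbol y_5^{(k)}=\boldsymbol x_k+\Delta_k\boldsymbol d_1^{(k)}$. Minimize $Q_k^{\rm mod}(\alpha,\beta)$ subject to $\alpha^2+\beta^2\le\Delta_k^2$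 and let $\boldsymbol x_k^{\rm mod}$ be the corresponding point $\boldsymbol x_k+\alpha\boldsymbol d_1^{(k)}+\beta\boldsymbol d_2^{(k)}$. If $\boldsymbol x_k^{\rm mod}\in\{\boldsymbol x_k,\boldsymbol x_{k-1}\}$, proceed as in (i). Otherwise replace $\boldsymbol x_k^+$ by a minimizer of $f$ over $\{\boldsymbol x_k^+,\boldsymbol x_k^{\rm mod}\}$ and recompute $\rho_k$ by the same formula. If $\rho_k\ge\eta_0$, set $\boldsymbol x_{k+1}=\boldsymbol x_k^+$; otherwise set $\boldsymbol x_{k+1}=\boldsymbol x_k$ and $\boldsymbol d_1^{(k+1)}=\boldsymbol d_1^{(k)}$ (overriding the update of Step 4). Go to Step 4. Step 4 (updating). If $\Delta_k<\Delta_{\rm low}$, terminate. Otherwise (unless overridden) set $\Delta_{k+1}=\gamma_1\Delta_k$ if $\rho_k\ge\eta$, $\Delta_{k+1}=\gamma_2\Delta_k$ otherwise, and $\boldsymbol d_1^{(k+1)}=(\boldsymbol x_{k+1}-\boldsymbol x_k)/\|\boldsymbol x_{k+1}-\boldsymbol x_k\|_2$. Let $\boldsymbol d_*^{(k+1)}\in\operatorname{span}\{\boldsymbol d_1^{(k)},\boldsymbol d_2^{(k)}\}$ be orthogonal to $\boldsymbol d_1^{(k+1)}$, and let $Q_k^+(\alpha,\beta)=f(\boldsymbol x_{k+1})+\bar a^{(k)}\alpha+\bar b^{(k)}\alpha^2+\bar c^{(k)}\beta+\bar d^{(k)}\beta^2+\bar e^{(k)}\alpha\beta$ be determined by $Q_k^+(\mathcal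 T^{(k+1)}_{\boldsymbol d_1^{(k+1)},\boldsymbol d_*^{(k+1)}}(\boldsymbol z))=f(\boldsymbol z)$ for all $\boldsymbol z$ in a set of six points, chosen from $\{\boldsymbol x_{k-1},\boldsymbol x_k,\boldsymbol x_{k+1},\boldsymbol y_1^{(k)},\dots,\boldsymbol y_5^{(k)}\}$, for which quadratic interpolation is uniquely solvable. Put $Q_{k+1}^{\rm sub}(\alpha)=Q_k^+(\alpha,0)$, increase $k$ by one and go to Step 1. *)

(* Defs.v *)
From HB Require Import structures.
From mathcomp Require Export all_boot all_order all_algebra.
From mathcomp Require Export all_classical all_reals all_analysis.
Export Order.TTheory GRing.Theory Num.Theory.
Export numFieldNormedType.Exports.

Set Implicit Arguments.
Unset Strict Implicit.
Unset Printing Implicit Defensive.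

#[export] Set Implicit Arguments.
#[export] Unset Strict Implicit.
#[export] Unset Printing Implicit Defensive.

Local Open Scope classical_set_scope.
Local Open Scope ring_scope.

Section Euclidean.
Context {R : realType} {n : nat}.
Implicit Types (u v : 'rV[R]_n) (V : {vspace 'rV[R]_n}).

Definition dot u v : R := \sum_i u 0 i * v 0 i.

(* The canonical norm on 'rV[R]_n is the sup norm; it induces the same topology
   and the same differentials as this one. *)
Definition enorm u : R := Num.sqrt (dot u u).

Definition normalize u : 'rV[R]_n := (enorm u)^-1 *: u.

Definition orthogonal_projection V (P : 'rV[R]_n -> 'rV[R]_n) : Prop :=
  forall v, P v \in V /\ (forall w, w \in V -> dot (v - P v) w = 0).

(* Operator norm induced by enorm; the set is bounded, so sup is the genuine
   supremum. Row vectors are acted upon from the right. *)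
Definition opnorm (A : 'M[R]_n) : R :=
  sup [set enorm (v *m A) | v in [set v | enorm v <= 1]].

Definition grad (f : 'rV[R]_n -> R) (x : 'rV[R]_n) : 'rV[R]_n :=
  \row_i 'D_(delta_mx 0 i) f x.

Definition hessian (f : 'rV[R]_n -> R) (x : 'rV[R]_n) : 'M[R]_n :=
  'J (grad f) x.

Definition twice_continuously_differentiable (f : 'rV[R]_n -> R) : Prop :=
  [/\ forall x, differentiable f x,
      forall x, differentiable (grad f) x
    & continuous (hessian f)].

End Euclidean.

Section Minimizers.
Context {R : realType} {T : Type}.

Definition minimizer (g : T -> R) (S : set T) (x : T) : Prop :=
  S x /\ forall z, S z -> g x <= g z.

Definition maximizer (g : T -> R) (S : set T) (x : T) : Prop :=
  S x /\ forall z, S z -> g z <= g x.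

End Minimizers.

Section BivariateQuadratics.
Context {R : realType}.

(* Quad q0 a b c d e is q0 + a alpha + b alpha^2 + c beta + d beta^2
   + e alpha beta. *)
Record quad := Quad {
  coef_1 : R; coef_a : R; coef_aa : R; coef_b : R; coef_bb : R; coef_ab : R
}.

Definition qeval (q : quad) (p : R * R) : R :=
  coef_1 q + coef_a q * p.1 + coef_aa q * p.1 ^+ 2
  + coef_b q * p.2 + coef_bb q * p.2 ^+ 2 + coef_ab q * p.1 * p.2.

Definition uniquely_solvable (p : 'I_6 -> R * R) : Prop :=
  forall v : 'I_6 -> R, exists! q : quad, forall i, qeval q (p i) = v i.

Definition disc (r : R) : set (R * R) :=
  [set p | p.1 ^+ 2 + p.2 ^+ 2 <= r ^+ 2].

End BivariateQuadratics.
Arguments quad : clear implicits.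

Section MoSub.
Context {R : realType} {n : nat}.
Notation vec := ('rV[R]_n).
Variable f : vec -> R.

(* The coordinate maps are only meaningful on o + <[a]> and
   o + <<[:: a; b]>>; the formulas extend them to the whole space, but the
   algorithm evaluates them only at points of these affine subspaces. *)
Definition coord1 (o a y : vec) : R := dot (y - o) a.
Definition coord2 (o a b y : vec) : R * R := (dot (y - o) a, dot (y - o) b).

Definition plane_point (o a b : vec) (p : R * R) : vec :=
  o + p.1 *: a + p.2 *: b.

Record parameters := MkParameters {
  start : vec;
  start_dir : vec;
  radius1 : R;
  radius_low : R;
  gamma1 : R;
  gamma2 : R;
  eta : R;
  eta0 : R
}.

Definition admissible (par : parameters) : Prop :=
  [/\ 0 < radius1 par, 1 <= gamma1 par, 0 < gamma2 par < 1,
      0 < eta par & 0 < eta0 par].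

(* Everything below except iterate is meaningful only at indices k >= 1;
   iterate 0 is the starting point x_0. subcoefs k is (a^(k), b^(k)), so that
   Q_k^sub(alpha) = f(x_k) + a^(k) alpha + b^(k) alpha^2. *)
Record trace := MkTrace {
  iterate : nat -> vec;
  radius : nat -> R;
  dir1 : nat -> vec;
  dir2 : nat -> vec;
  subcoefs : nat -> R * R
}.

Definition initialization (par : parameters) (t : trace) : Prop :=
  let D := radius1 par in
  let d := start_dir par in
  let ya := start par in
  let yb := start par + D *: d in
  let yc := if f ya <= f yb then ya + (2 * D) *: d else ya - D *: d in
  let Y := [set ya; yb; yc] in
  let x1 := iterate t 1 in
  [/\ iterate t 0 = start par,
      radius t 1 = D,
      minimizer f Y x1,
      exists ymax, [/\ maximizer f Y ymax, ymax != x1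
                     & dir1 t 1 = normalize (x1 - ymax)]
    & forall y, Y y ->
        let alpha := coord1 x1 (dir1 t 1) y in
        f x1 + (subcoefs t 1).1 * alpha + (subcoefs t 1).2 * alpha ^+ 2 = f y].

Definition y1 (x : vec) (D : R) (d2 : vec) : vec := x + D *: d2.
Definition y2 (x : vec) (D : R) (d2 : vec) : vec :=
  if f (y1 x D d2) <= f x then x + (2 * D) *: d2 else x - D *: d2.
Definition y4 (x : vec) (D : R) (d1 d2 : vec) : vec :=
  x + (Num.sqrt 2 / 2 * D) *: d1 + (Num.sqrt 2 / 2 * D) *: d2.
Definition y5 (x : vec) (D : R) (d1 : vec) : vec := x + D *: d1.

Definition interpolates (o d1 d2 : vec) (q : quad R) (z : vec) : Prop :=
  qeval q (coord2 o d1 d2 z) = f z.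

(* If the predicted change is 0, the quotient is 0 by the convention of
   MathComp, hence below the positive thresholds eta and eta0. *)
Definition ratio (x d1 d2 : vec) (Q : quad R) (z : vec) : R :=
  (f z - f x) / (qeval Q (coord2 x d1 d2 z) - qeval Q (0, 0)).

Definition next_radius (par : parameters) (D rho : R) : R :=
  if eta par <= rho then gamma1 par * D else gamma2 par * D.

Definition mod_points (xprev x xp z1 z2 z3 z4 z5 : vec) : set vec :=
  if x != xprev then [set xprev; x; xp; z1; z2; z3]
  else if xp != z4 then [set x; xp; z1; z2; z3; z4]
  else [set x; xp; z1; z2; z3; z5].

(* mod_trial ... xm: xm is a possible x_k^mod. The interpolant is only required
   to exist: if the six points fail to determine it, any one is allowed. *)
Definition mod_trial (xprev x : vec) (D : R) (d1 d2 z3 xp xm : vec) : Prop :=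
  exists (Qmod : quad R) (p : R * R),
    [/\ forall z, mod_points xprev x xp (y1 x D d2) (y2 x D d2) z3
                    (y4 x D d1 d2) (y5 x D d1) z ->
          interpolates x d1 d2 Qmod z,
        minimizer (qeval Qmod) (disc D) p
      & xm = plane_point x d1 d2 p].

(* update par xprev x D d1 d2 z3 Q xp x' D' d1': from the trial minimizer
   xp = x_k^+, Step 3 together with the updates of the radius and of d_1 in
   Step 4 may produce x_{k+1} = x', Delta_{k+1} = D', d_1^(k+1) = d1'. *)
Inductive update (par : parameters) (xprev x : vec) (D : R) (d1 d2 z3 : vec)
    (Q : quad R) (xp : vec) : vec -> R -> vec -> Prop :=
| StepNull of
    [set x; xprev] xp :
    update par xprev x D d1 d2 z3 Q xp x D d1
| StepAccept of
    ~ [set x; xprev] xp &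
    eta par <= ratio x d1 d2 Q xp \/ [set y1 x D d2; y2 x D d2; z3] xp :
    update par xprev x D d1 d2 z3 Q xp
      xp (next_radius par D (ratio x d1 d2 Q xp)) (normalize (xp - x))
| StepModNull xm of
    ~ [set x; xprev] xp &
    ratio x d1 d2 Q xp < eta par &
    ~ [set y1 x D d2; y2 x D d2; z3] xp &
    mod_trial xprev x D d1 d2 z3 xp xm &
    [set x; xprev] xm :
    update par xprev x D d1 d2 z3 Q xp x D d1
| StepModAccept xm xp' of
    ~ [set x; xprev] xp &
    ratio x d1 d2 Q xp < eta par &
    ~ [set y1 x D d2; y2 x D d2; z3] xp &
    mod_trial xprev x D d1 d2 z3 xp xm &
    ~ [set x; xprev] xm &
    minimizer f [set xp; xm] xp' &
    eta0 par <= ratio x d1 d2 Q xp' :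
    update par xprev x D d1 d2 z3 Q xp
      xp' (next_radius par D (ratio x d1 d2 Q xp')) (normalize (xp' - x))
| StepModReject xm xp' of
    ~ [set x; xprev] xp &
    ratio x d1 d2 Q xp < eta par &
    ~ [set y1 x D d2; y2 x D d2; z3] xp &
    mod_trial xprev x D d1 d2 z3 xp xm &
    ~ [set x; xprev] xm &
    minimizer f [set xp; xm] xp' &
    ratio x d1 d2 Q xp' < eta0 par :
    update par xprev x D d1 d2 z3 Q xp
      x (next_radius par D (ratio x d1 d2 Q xp')) d1.

(* Unique solvability at the six points forces dstar <> 0; dstar need not be a
   unit vector. *)
Definition sub_update (xprev x : vec) (D : R) (d1 d2 z3 x' d1' : vec)
    (ab : R * R) : Prop :=
  exists (dstar : vec) (z : 'I_6 -> vec) (c d e : R),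
    let Qplus := Quad (f x') ab.1 ab.2 c d e in
    [/\ dstar \in <<[:: d1; d2]>>%VS /\ dot dstar d1' = 0,
        forall i, [set xprev; x; x'; y1 x D d2; y2 x D d2; z3;
                       y4 x D d1 d2; y5 x D d1] (z i),
        uniquely_solvable (fun i => coord2 x' d1' dstar (z i))
      & forall i, interpolates x' d1' dstar Qplus (z i)].

(* One full pass k -> k+1. The conjunct on radius_low says that the termination
   test of Step 4 fails. *)
Definition iteration (par : parameters) (t : trace) (k : nat) : Prop :=
  let xprev := iterate t k.-1 in
  let x := iterate t k in
  let D := radius t k in
  let d1 := dir1 t k in
  let d2 := dir2 t k in
  [/\ enorm d2 = 1,
      dot d1 d2 = 0,
      ~ (D < radius_low par)
    & exists (ymin2 : vec) (c d e : R) (p : R * R) (xp : vec),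
        let z1 := y1 x D d2 in
        let z2 := y2 x D d2 in
        let z3 := ymin2 + D *: d1 in
        let Q := Quad (f x) (subcoefs t k).1 (subcoefs t k).2 c d e in
        [/\ minimizer f [set z1; z2] ymin2,
            forall z, [set z1; z2; z3] z -> interpolates x d1 d2 Q z,
            minimizer (qeval Q) (disc D) p,
            minimizer f [set x; plane_point x d1 d2 p; z1; z2; z3] xp
          & update par xprev x D d1 d2 z3 Q xp
              (iterate t k.+1) (radius t k.+1) (dir1 t k.+1)
            /\ sub_update xprev x D d1 d2 z3
                 (iterate t k.+1) (dir1 t k.+1) (subcoefs t k.+1)]].

Definition infinite_run (par : parameters) (t : trace) : Prop :=
  [/\ admissible par, initialization par t
    & forall k, (1 <= k)%N -> iteration par t k].

End MoSub.
Arguments parameters : clear implicits.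
Arguments trace : clear implicits.

(* Main.v *)
(** The iterates never increase f, so f(x_k) converges and
    f(x_k) - f(x_{k+1}) tends to 0.  Since the Hessian is bounded by M > 0, the
    step - P_k g / M with g the gradient at x_k stays in V_k and decreases f by
    at least |P_k g|^2 / (2 M).  By assumption 2, x_{k+1} achieves this decrease
    up to o(1) along K, so P_k g, and by assumption 1 also g, tends to 0 along
    K. *)
From HB Require Import structures.
Require Import Defs.
From mathcomp Require Import ring lra.
Local Open Scope classical_set_scope.
Local Open Scope ring_scope.

(** * Euclidean inner product, norm and operator norm *)

Section Dot.
Context {R : realType} {n : nat}.
Implicit Types (u v w : 'rV[R]_n) (a : R).

Lemma dotC u v : dot u v = dot v u.
Proof. by apply: eq_bigr => i _; rewrite mulrC. Qed.

Lemma dotDl u v w : dot (u + v) w = dot u w + dot v w.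
Proof. by rewrite -big_split; apply: eq_bigr => i _; rewrite mxE mulrDl. Qed.

Lemma dotZl a u v : dot (a *: u) v = a * dot u v.
Proof. by rewrite /dot mulr_sumr; apply: eq_bigr => i _; rewrite mxE mulrA. Qed.

Lemma dotZr a u v : dot u (a *: v) = a * dot u v.
Proof. by rewrite dotC dotZl dotC. Qed.

Lemma dotDr u v w : dot u (v + w) = dot u v + dot u w.
Proof. by rewrite ![dot u _]dotC dotDl. Qed.

Lemma dot_ge0 u : 0 <= dot u u.
Proof. by apply: sumr_ge0 => i _; rewrite -expr2 sqr_ge0. Qed.

Lemma sqr_enorm u : enorm u ^+ 2 = dot u u.
Proof. by rewrite sqr_sqrtr ?dot_ge0. Qed.

Lemma enorm_ge0 u : 0 <= enorm u.
Proof. exact: sqrtr_ge0. Qed.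

Lemma enormZ a u : 0 <= a -> enorm (a *: u) = a * enorm u.
Proof.
move=> a0; rewrite /enorm dotZl dotZr mulrA -expr2 sqrtrM ?sqr_ge0 //.
by rewrite sqrtr_sqr ger0_norm.
Qed.

Lemma enorm0 : enorm (0 : 'rV[R]_n) = 0.
Proof. by rewrite -(scale0r 0) enormZ // mul0r. Qed.

Lemma enorm_eq0 u : enorm u = 0 -> u = 0.
Proof.
move=> u0; apply/rowP => i; rewrite mxE; apply/eqP.
have /eqP : dot u u = 0 by rewrite -sqr_enorm u0 expr0n.
rewrite psumr_eq0 => [/allP /(_ i)|j _]; last by rewrite -expr2 sqr_ge0.
by rewrite mem_index_enum mulf_eq0 orbb; apply.
Qed.

(** Cauchy-Schwarz: expand the squared norm of [|v| u - |u| v], which is nonnegative, and cancel the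
    factor [|u| |v|]. Zero vectors are split off so that this factor is positive. *)
Lemma dot_le_enorm u v : dot u v <= enorm u * enorm v.
Proof.
have [u0|u0] := eqVneq (enorm u) 0.
  by rewrite u0 (enorm_eq0 u0) -(scale0r 0) dotZl !mul0r.
have [v0|v0] := eqVneq (enorm v) 0.
  by rewrite v0 (enorm_eq0 v0) -(scale0r 0) dotZr mulr0 mul0r.
have up : 0 < enorm u by rewrite lt_neqAle eq_sym u0 enorm_ge0.
have vp : 0 < enorm v by rewrite lt_neqAle eq_sym v0 enorm_ge0.
have := dot_ge0 (enorm v *: u + (- enorm u) *: v).
rewrite dotDl !dotDr !(dotZl, dotZr) -!sqr_enorm (dotC v u) => h.
rewrite -(ler_pM2l (mulr_gt0 up vp)); nra.
Qed.

Lemma coord_le_enorm u i : `|u 0 i| <= enorm u.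
Proof.
rewrite -sqrtr_sqr; apply: ler_wsqrtr.
rewrite /dot (bigD1 i) //= -expr2 lerDl.
by apply: sumr_ge0 => j _; rewrite -expr2 sqr_ge0.
Qed.

(** Makes the [sup] in [opnorm] a true supremum instead of a default value. Coordinates of [v] are
    at most 1 in absolute value, so the [j]-th entry of [v *m A] is dominated by the absolute sum of
    column [j]. *)
Lemma enorm_mulmx_bounded (A : 'M[R]_n) :
  has_ubound [set enorm (v *m A) | v in [set v | enorm v <= 1]].
Proof.
exists (Num.sqrt (\sum_j (\sum_i `|A i j|) ^+ 2)) => _ [v /= v1 <-].
apply: ler_wsqrtr; apply: ler_sum => j _; rewrite -expr2 -real_normK ?num_real //.
rewrite ler_sqr ?nnegrE ?normr_ge0 ?sumr_ge0 //.
rewrite mxE; apply: le_trans (ler_norm_sum _ _ _) _.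
apply: ler_sum => i _; rewrite normrM ler_piMl //.
exact: le_trans (coord_le_enorm v i) v1.
Qed.

Lemma enorm_mulmx_le (A : 'M[R]_n) v : enorm (v *m A) <= opnorm A * enorm v.
Proof.
have [v0|v0] := eqVneq (enorm v) 0.
  by rewrite v0 (enorm_eq0 v0) mul0mx enorm0 mulr0.
have vp : 0 < enorm v by rewrite lt_neqAle eq_sym v0 enorm_ge0.
rewrite -ler_pdivrMr // mulrC -enormZ ?invr_ge0 ?enorm_ge0 // scalemxAl.
apply: ub_le_sup; first exact: enorm_mulmx_bounded.
exists ((enorm v)^-1 *: v) => //=.
by rewrite enormZ ?invr_ge0 ?enorm_ge0 // mulVf.
Qed.

Lemma dot_mulmx_le (A : 'M[R]_n) v : dot (v *m A) v <= opnorm A * enorm v ^+ 2.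
Proof.
apply: le_trans (dot_le_enorm _ _) _.
by rewrite expr2 mulrA ler_wpM2r ?enorm_ge0 // enorm_mulmx_le.
Qed.

(** The residual [v - P v] is orthogonal to [V], and [P v] itself lies in [V]. *)
Lemma orthogonal_projection_dot (V : {vspace 'rV[R]_n}) P v :
  orthogonal_projection V P -> dot v (P v) = enorm (P v) ^+ 2.
Proof.
move=> /(_ v) [PV /(_ _ PV)].
by rewrite dotDl -scaleN1r dotZl mulN1r sqr_enorm => /subr0_eq.
Qed.

End Dot.

(** * Derivatives along lines and a second-order Taylor bound *)

Section Taylor.
Context {R : realType} {n : nat}.
Implicit Types (f : 'rV[R]_n -> R) (x v : 'rV[R]_n).

Lemma is_derive_line (W : normedModType R) (F : 'rV[R]_n -> W) x v (s : R) :
  differentiable F (x + s *: v) ->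
  is_derive s 1 (fun s => F (x + s *: v)) ('d F (x + s *: v) v).
Proof.
move=> dF.
have dl : is_diff s (fun s : R => x + s *: v) (fun h : R => h *: v).
  by apply: is_diff_eq; rewrite add0r.
have dc : is_diff s (F \o (fun s : R => x + s *: v))
   ('d F (x + s *: v) \o (fun h : R => h *: v)).
  apply: is_diff_comp; exact: differentiableP.
split; first exact/diff_derivable/ex_diff.
by rewrite deriveE ?diff_val /= ?scale1r; last exact: ex_diff.
Qed.

Lemma diff_dot_grad f x v : differentiable f x -> 'd f x v = dot (grad f x) v.
Proof.
move=> df; rewrite [in LHS](row_sum_delta v) linear_sum.
by apply: eq_bigr => i _; rewrite linearZ mxE deriveE //= mulrC.
Qed.

Lemma diff_grad_hessian f x v : 'd (grad f) x v = v *m hessian f x.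
Proof. by rewrite /hessian /jacobian mul_rV_lin1. Qed.

(** A linear map is its own differential once it is continuous; continuity holds because it is a
    finite sum of scaled coordinate functions. *)
Lemma is_diff_dotl v u : is_diff u (fun w => dot w v) (fun w => dot w v).
Proof.
have lin : linear (fun w : 'rV[R]_n => dot w v : R^o).
  by move=> a w1 w2; rewrite dotDl dotZl.
pose linM := GRing.isLinear.Build _ _ _ _ _ lin.
pose L : {linear 'rV[R]_n -> R^o} :=
  HB.pack (fun w : 'rV[R]_n => dot w v : R^o) linM.
have cL : continuous L.
  move=> w; apply/differentiable_continuous.
  rewrite (_ : (L : _ -> _) = \sum_i (fun w : 'rV[R]_n => w 0 i * v 0 i)).
    apply: differentiable_sum => i; apply: differentiableM => //.
    exact: differentiable_coord.
  by apply/funext => z; rewrite fct_sumE.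
apply: DiffDef; [exact: (linear_differentiable u cL)|exact: (diff_lin u cL)].
Qed.

Lemma is_derive_dot_line (F : 'rV[R]_n -> 'rV[R]_n) x v (s : R) :
  differentiable F (x + s *: v) ->
  is_derive s 1 (fun s => dot (F (x + s *: v)) v) (dot ('d F (x + s *: v) v) v).
Proof.
move=> dF.
have dc : is_diff (x + s *: v) ((fun w => dot w v) \o F)
    ((fun w => dot w v) \o 'd F (x + s *: v)).
  by apply: is_diff_comp; [exact: differentiableP|exact: is_diff_dotl].
have := is_derive_line (@ex_diff _ _ _ _ _ _ _ dc).
by rewrite diff_val.
Qed.

(** Two applications of the mean value theorem: one to the slope [g] along the segment, one to [f]
    minus the quadratic candidate bound. No integral remainder and no sign of [C] enter. *)
Lemma taylor2_le f x v (C : R) : twice_continuously_differentiable f ->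
  (forall y, opnorm (hessian f y) <= C) ->
  f (x + v) <= f x + dot (grad f x) v + C / 2 * enorm v ^+ 2.
Proof.
move=> [df ddf _] fC.
set M := C * enorm v ^+ 2.
pose g (s : R) := dot (grad f (x + s *: v)) v.
have dfl (s : R) : is_derive s 1 (fun s : R => f (x + s *: v)) (g s).
  rewrite /g -diff_dot_grad //; exact: is_derive_line.
have dgl (s : R) : is_derive s 1 g (dot (v *m hessian f (x + s *: v)) v).
  by rewrite -diff_grad_hessian; exact: is_derive_dot_line.
have gM (s : R) : 0 < s -> g s - g 0 <= M * s.
  move=> s0; have [|c _ ->] := @MVT _ g _ 0 s s0 (fun s _ => dgl s).
    apply: continuous_subspaceT => y; apply/differentiable_continuous.
    exact/derivable1_diffP/ex_derive.
  rewrite subr0 ler_wpM2r ?(ltW s0) //.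
  apply: le_trans (dot_mulmx_le _ _) _.
  by rewrite ler_wpM2r ?exprn_ge0 ?enorm_ge0.
(* By [gM], [h] has nonpositive derivative for positive [s], so [h 1 <= h 0], which is the claim. *)
pose h (s : R) := f (x + s *: v) - (g 0 * s + M / 2 * s ^+ 2).
have dh (s : R) : is_derive s 1 h (g s - (g 0 + M * s)).
  by apply: is_derive_eq; rewrite /GRing.scale /=; lra.
have [|c c01] := @MVT _ h _ 0 1 ltr01 (fun s _ => dh s).
  apply: continuous_subspaceT => y; apply/differentiable_continuous.
  exact/derivable1_diffP/ex_derive.
have /gM : 0 < c by move: c01; rewrite in_itv => /andP[].
rewrite /h /g /M !scale1r !scale0r !addr0 expr0n /= ; lra.
Qed.

End Taylor.

(** [M] is kept apart from [C] because the step length [1 / M] needs a positive number, and [C] may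
    be 0. *)
Lemma projected_step_decrease {R : realType} {n : nat} (f : 'rV[R]_n -> R)
    x (V : {vspace 'rV[R]_n}) P (C M : R) :
  twice_continuously_differentiable f ->
  (forall y, opnorm (hessian f y) <= C) -> C <= M -> 0 < M ->
  orthogonal_projection V P -> has_lbound (range f) ->
  enorm (P (grad f x)) ^+ 2 / (2 * M) <=
    f x - inf [set f (x + d) | d in [set` V]].
Proof.
move=> f2 fC CM M0 VP [m fm].
set g := grad f x; set q := enorm (P g) ^+ 2.
have q0 : 0 <= q by rewrite exprn_ge0 ?enorm_ge0.
have hl : has_lbound [set f (x + d) | d in [set` V]].
  by exists m => _ [d _ <-]; apply: fm; exists (x + d).
have /(ge_inf hl) le1 :
    [set f (x + d) | d in [set` V]] (f (x + (- M^-1) *: P g)).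
  by exists ((- M^-1) *: P g) => //=; apply: memvZ; case: (VP g).
have := taylor2_le x ((- M^-1) *: P g) f2 fC.
rewrite dotZr (orthogonal_projection_dot _ VP) -/g -/q.
rewrite !sqr_enorm dotZl dotZr -sqr_enorm -/q => le2.
have : C / 2 * (- M^-1 * (- M^-1 * q)) <= M / 2 * (- M^-1 * (- M^-1 * q)).
  apply: ler_wpM2r; last lra.
  by rewrite mulrA mulrNN mulr_ge0 // -expr2 sqr_ge0.
(* In units of [q / (2 * M)] the quadratic term costs at most 1 and the linear term gains 2, leaving
   a net decrease of 1. *)
have -> : M / 2 * (- M^-1 * (- M^-1 * q)) = q / (2 * M) by field; rewrite gt_eqF.
have : - M^-1 * q = - (2 * (q / (2 * M))) by field; rewrite gt_eqF.
lra.
Qed.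

(** * Monotonicity of [f] along a run *)

Section Run.
Context {R : realType} {n : nat} (f : 'rV[R]_n -> R).

(** Every branch returns [x], [xp], or a minimizer over a set containing [xp]. *)
Lemma update_le par xprev x D d1 d2 z3 Q xp x' D' d1' : f xp <= f x ->
  update f par xprev x D d1 d2 z3 Q xp x' D' d1' -> f x' <= f x.
Proof.
move=> lexp; case=> // xm xp' _ _ _ _ _ [_ /(_ xp) le' _].
by apply: le_trans lexp; apply: le'; left.
Qed.

Lemma iterate_le par t k : infinite_run f par t ->
  f (iterate t k.+1) <= f (iterate t k).
Proof.
case=> _ init it; case: k => [|k].
  (* The passage from index 0 to 1 is the initialization: the starting point is among the three
     points over which the first iterate minimizes [f]. *)
  by case: init => -> _ [_ le1] _ _; apply: le1; left; left.
case: (it k.+1 isT) => _ _ _ [ymin2 [c [d [e [p [xp [_ _ _ [_ minp] [upd _]]]]]]]].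
by apply: update_le upd; apply: minp; do 4!left.
Qed.

Lemma decrease_cvg0 par (t : trace R n) : infinite_run f par t -> has_lbound (range f) ->
  f (iterate t k) - f (iterate t k.+1) @[k --> \oo] --> (0 : R).
Proof.
move=> run [m fm].
have cv : cvgn (fun k => f (iterate t k)).
  apply: nonincreasing_is_cvgn.
    by apply/nonincreasing_seqP => k; exact: iterate_le run.
  by exists m => _ [k _ <-]; apply: fm; exists (iterate t k).
(* A convergent sequence and its shift share their limit, so 0 is written as that limit minus
   itself. *)
rewrite -(subrr (limn (fun k => f (iterate t k)))).
apply: cvgB => //.
by rewrite (cvg_shiftS (fun k => f (iterate t k))).
Qed.

End Run.

(** * Passage to the lower limit along an infinite index set *)

Lemma infinite_set_cofinal (K : set nat) N : infinite_set K ->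
  exists2 k, K k & (N <= k)%N.
Proof.
move=> Kinf; apply: contrapT => nK; apply: Kinf.
apply: sub_finite_set (finite_II N) => k Kk /=.
by rewrite ltnNge; apply/negP => Nk; apply: nK; exists k.
Qed.

(** Every tail infimum is already 0: nonnegativity bounds it below, and arbitrarily small values
    beyond any [N] bound it above. *)
Lemma limn_einf_eq0 {R : realType} (u : nat -> R) : (forall k, 0 <= u k) ->
  (forall e N, 0 < e -> exists2 k, (N <= k)%N & u k <= e) ->
  limn_einf (fun k => (u k)%:E) = 0%E.
Proof.
move=> u0 us; rewrite limn_einf_lim (_ : einfs _ = cst 0%E) ?lim_cst //.
apply/funext => N /=; apply/eqP; rewrite eq_le; apply/andP; split.
  apply/lee_addgt0Pr => e /(us _ N) [k Nk uke]; rewrite add0e.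
  by apply: ge_ereal_inf; exists (u k)%:E; [exists k|rewrite lee_fin].
by apply: le_ereal_inf_tmp => _ [k _ <-]; rewrite lee_fin.
Qed.

Theorem theorem4p7 (R : realType) (n : nat) (f : 'rV[R]_n -> R)
    (par : parameters R n) (t : trace R n)
    (P : nat -> 'rV[R]_n -> 'rV[R]_n) (C : R) (K : set nat) (eps1 : R)
    (x := iterate t)
    (V := fun k : nat => <<[:: dir1 t k; dir2 t k]>>%VS) :
  (2 <= n)%N ->
  infinite_run f par t ->
  (forall k, (1 <= k)%N -> orthogonal_projection (V k) (P k)) ->
  has_lbound (range f) ->
  twice_continuously_differentiable f ->
  (forall y, opnorm (hessian f y) <= C) ->
  infinite_set K ->
  K `<=` [set k | (1 <= k)%N] ->
  0 < eps1 ->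
  (forall k, K k -> eps1 * enorm (grad f (x k)) <= enorm (P k (grad f (x k)))) ->
  f (x k.+1) - inf [set f (x k + d) | d in [set` V k]]
    @[k --> within K \oo] --> (0 : R) ->
  limn_einf (fun k => (enorm (grad f (x k)))%:E) = 0%E.
Proof.
move=> _ run VP fb f2 fC Kinf K1 eps0 gP gap.
apply: limn_einf_eq0 => [k|e N e0]; first exact: enorm_ge0.
(* The maximum with 1 ensures positivity and still bounds the Hessian. *)
pose M := Num.max C 1.
have CM : C <= M by rewrite le_max lexx.
have M0 : 0 < M by rewrite lt_max ltr01 orbT.
(* [r] is the decrease guaranteed when the gradient norm exceeds [e]. The one-step decrease and the
   gap of assumption 2 are each made smaller than [r / 2]. *)
pose r := (eps1 * e) ^+ 2 / (2 * M).
have r0 : 0 < r / 2 by rewrite !divr_gt0 ?exprn_gt0 ?mulr_gt0.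
have /cvgr0_norm_lt /(_ _ r0) [N1 _ dec] := decrease_cvg0 run fb.
have /cvgr0_norm_lt /(_ _ r0) [N2 _ small] := gap.
have [k Kk] := infinite_set_cofinal (maxn N (maxn N1 N2)) Kinf.
rewrite !geq_max => /and3P[Nk /dec /ltr_normlW d1 /small /(_ Kk) /ltr_normlW d2].
exists k => //; rewrite leNgt; apply/negP => eg.
have := projected_step_decrease (x k) f2 fC CM M0 (VP _ (K1 _ Kk)) fb.
(* [f (x k) - inf] is the one-step decrease plus the gap, hence below [r], while the projected
   gradient forces at least [r]. *)
apply/negP; rewrite -ltNge.
have : r <= enorm (P k (grad f (x k))) ^+ 2 / (2 * M).
  apply: ler_wpM2r; first by rewrite invr_ge0 mulr_ge0 // ltW.
  have le_eg : eps1 * e <= enorm (P k (grad f (x k))).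
    apply: le_trans (gP _ Kk); apply: ler_wpM2l; exact: ltW.
  by rewrite ler_sqr ?nnegrE ?enorm_ge0 // mulr_ge0 // ltW.
move: d1 d2; rewrite /V /x; lra.
Qed.
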